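(* Let $A$ be a finitely generated commutative $\mathbb{R}$-algebra with $1$ and let $M$ be an arbitrary quadratic module of $A$. Then $$\operatorname{Pos}(\mathcal{K}_M)=\operatorname{Pos}(\mathcal{Y}_M)^{\ddagger}=\overline{\operatorname{Pos}(\mathcal{Y}_M)}.$$
   Context: $\mathbb{R}^+$ denotes the set of nonnegative real numbers. A quadratic module of $A$ is a subset $Q\subseteq A$ with $Q+Q\subseteq Q$, $f^2Q\subseteq Q$ for all $f\in A$, and $1\in Q$. A semiordering of $A$ is a quadratic module $Q$ of $A$ such that $Q\cup -Q=A$ and $Q\cap -Q$ is a prime ideal of $A$. For a quadratic module $M$, $\mathcal{Y}_M$ is the set of all semiorderings of $A$ containing $M$, and $\mathcal{K}_M\subseteq\mathcal{Y}_M$ is the set of those of the form $\alpha^{-1}(\mathbb{R}^+)$ for some ring homomorphism $\alpha:A\to\mathbb{R}$ with $M\subseteq\alpha^{-1}(\mathbb{R}^+)$. For a set $\mathcal{Y}$ of semiorderings, $\operatorname{Pos}(\mathcal{Y}):=\bigcap_{Q\in\mathcal{Y}}Q$ (equal to $A$ if $\mathcal{Y}=\emptyset$). $A$ is endowed, as a real vector space, with the finest locally convex topology (the vector space topology for which all convex, absorbent, symmetric subsets form a zero neighborhood base; $U$ is absorbent if for each $x$ there is $\lambda>0$ with $x\in\lambda U$, and symmetric if $\lambda U\subseteq U$ for all $|\lambda|\le 1$). For $C\subseteq A$, $\overline{C}$ is the closure of $C$ in this topology, and $C^{\ddagger}$ (the sequential closure) is the set of all elements of $A$ that are limits of sequences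 of elements of $C$. *)

(* Defs.v *)
From HB Require Import structures.
From mathcomp Require Import all_boot all_order all_algebra.
From mathcomp Require Import all_classical all_reals all_analysis.
Set Implicit Arguments.
Unset Strict Implicit.
Unset Printing Implicit Defensive.
Import Order.TTheory GRing.Theory Num.Theory.
Import numFieldNormedType.Exports.
Local Open Scope classical_set_scope.
Local Open Scope ring_scope.

(* A commutative [R]-algebra is given by its structure map [phi : R -> A]:
   [comAlgType R] would exclude the zero algebra. The alias [ralg phi] is [A]
   with the scalar multiplication [r *: x = phi r * x]. *)
Section Algebra.
Variables (R : comPzRingType) (A : comPzRingType) (phi : {rmorphism R -> A}).

Definition ralg (f : {rmorphism R -> A}) : Type := A.
Local Notation B := (ralg phi).

HB.instance Definition _ := GRing.ComPzRing.on B.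

Let ralg_scale (r : R) (x : B) : B := phi r * x.

Let ralg_scaleA r s x : ralg_scale r (ralg_scale s x) = ralg_scale (r * s) x.
Proof. by rewrite /ralg_scale rmorphM mulrA. Qed.

Let ralg_scale1 : left_id 1 ralg_scale.
Proof. by move=> x; rewrite /ralg_scale rmorph1 mul1r. Qed.

Let ralg_scaleDr : right_distributive ralg_scale +%R.
Proof. by move=> r x y; rewrite /ralg_scale mulrDr. Qed.

Let ralg_scaleDl x : {morph ralg_scale^~ x : r s / r + s}.
Proof. by move=> r s; rewrite /ralg_scale rmorphD mulrDl. Qed.

HB.instance Definition _ := GRing.Zmodule_isLmodule.Build R B
  ralg_scaleA ralg_scale1 ralg_scaleDr ralg_scaleDl.

Definition subalgebra : set (set A) :=
  [set S | [/\ forall r, S (phi r), forall x y, S x -> S y -> S (x + y)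
             & forall x y, S x -> S y -> S (x * y)]].

Definition finitely_generated :=
  exists s : seq A, smallest subalgebra [set` s] = setT.

End Algebra.

Section FinestLocallyConvexTopology.
Context {R : realType}.

Section ZeroNeighbourhoods.
Context {V : lmodType R}.
Implicit Types U W : set V.

Definition absorbent U := forall x, exists2 l : R, 0 < l & ( *:%R l @` U) x.

Definition symmetric_set U := forall l : R, `|l| <= 1 -> *:%R l @` U `<=` U.

Definition flc_base : set (set V) :=
  [set U | [/\ convex_set (U : set (convex_lmodType V)), absorbent U
             & symmetric_set U]].

End ZeroNeighbourhoods.

Definition finest_lc (V : lmodType R) : Type := V.

Section Topology.
Variable V : lmodType R.
Local Notation E := (finest_lc V).

HB.instance Definition _ := GRing.Lmodule.on E.

Definition flc_nbhs (x : E) : set_system E :=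
  [set U | exists2 W : set V, flc_base W & forall w, W w -> U (x + w)].

HB.instance Definition _ := hasNbhs.Build E flc_nbhs.

Lemma flc_base_conv (W : set V) (u v : V) (s t : R) : flc_base W ->
  0 <= s -> 0 <= t -> s + t = 1 -> W u -> W v -> W (s *: u + t *: v).
Proof.
move=> [Wc _ _] s0 t0 st1 Wu Wv.
have s1 : s <= 1 by rewrite -st1 lerDl.
have s01 : Itv.spec (@Itv.num_sem R) (Itv.Real `[0%Z, 1%Z]) s.
  by apply/andP; split; [exact: ger0_real|rewrite /= in_itv/= s0 s1].
have : W (s *: u + (1 - s) *: v).
  exact: set_mem (Wc u v (Itv.mk s01 : {i01 R}) (mem_set Wu) (mem_set Wv)).
by rewrite (_ : 1 - s = t) // -st1 addrAC subrr add0r.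
Qed.

Lemma flc_base_sym (W : set V) (l : R) (u : V) : flc_base W ->
  `|l| <= 1 -> W u -> W (l *: u).
Proof. by move=> [_ _ Ws] l1 Wu; apply: (Ws _ l1); exists u. Qed.

Lemma flc_base0 (W : set V) : flc_base W -> W 0.
Proof.
move=> Wb; have [_ Wa _] := Wb; have [l _ [u Wu _]] := Wa 0.
by rewrite -(scale0r u); apply: flc_base_sym => //; rewrite normr0.
Qed.

Lemma flc_baseT : flc_base ([set: V]).
Proof.
split; [by move=> x y l _ _; rewrite inE| |by move=> l _ x _].
by move=> x; exists 1 => //; exists x => //; rewrite scale1r.
Qed.

Lemma flc_baseI (W1 W2 : set V) :
  flc_base W1 -> flc_base W2 -> flc_base (W1 `&` W2).
Proof.
move=> B1 B2; have [c1 a1 s1] := B1; have [c2 a2 s2] := B2; split.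
- move=> x y l; rewrite !inE => -[x1 x2] [y1 y2]; split.
  + by apply/set_mem/c1; exact/mem_set.
  + by apply/set_mem/c2; exact/mem_set.
- move=> x; have [l l0 [u Wu <-]] := a1 x; have [m m0 [v Wv uv]] := a2 (l *: u).
  have lm : 0 < l + m by exact: addr_gt0.
  exists (l + m) => //; exists ((l + m)^-1 *: (l *: u)); last first.
    by rewrite scalerA divff ?scale1r// gt_eqF.
  have H (k : R) : 0 < k -> k <= l + m -> `|(l + m)^-1 * k| <= 1.
    move=> k0 kl; rewrite ger0_norm; last by rewrite mulr_ge0 ?invr_ge0// ltW.
    by rewrite mulrC ler_pdivrMr// mul1r.
  split.
    by rewrite scalerA; apply: flc_base_sym => //; apply: H; rewrite ?lerDl ?ltW.
  rewrite -uv scalerA; apply: flc_base_sym => //.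
  by apply: H; rewrite ?lerDr ?ltW.
- move=> l l1 _ [u [u1 u2] <-]; split; exact: flc_base_sym.
Qed.

Lemma flc_baseZ (W : set V) (c : R) : 0 < c -> flc_base W ->
  flc_base [set x | W (c *: x)].
Proof.
move=> c0 B; have [cv a s] := B; split.
- move=> x y l; rewrite !inE/= => Wx Wy.
  have : W (l%:num *: (c *: x) + (1 - l%:num) *: (c *: y)).
    exact: set_mem (cv _ _ l (mem_set Wx) (mem_set Wy)).
  by rewrite !scalerA ![_ * c]mulrC -!scalerA -scalerDr.
- move=> x; have [l l0 [u Wu <-]] := a x.
  exists (l * c); first exact: mulr_gt0.
  exists (c^-1 *: u) => /=; rewrite scalerA ?mulfK ?mulfV ?scale1r// ?gt_eqF//.
- move=> l l1 _ [u Wu <-] /=.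
  by rewrite scalerA mulrC -scalerA; exact: flc_base_sym.
Qed.

Lemma flc_base_split (W : set V) : flc_base W -> exists2 W' : set V, flc_base W' &
  forall u v, W' u -> W' v -> W (u + v).
Proof.
move=> B; exists [set x | W ((2 : R) *: x)]; first exact: flc_baseZ.
move=> u v /= Wu Wv.
have h0 : 0 <= (2 : R)^-1 by rewrite invr_ge0.
have := flc_base_conv B h0 h0 _ Wu Wv.
rewrite !scalerA mulVf ?pnatr_eq0// !scale1r; apply.
by rewrite [RHS](splitr 1) mul1r.
Qed.

Let flc_nbhs_filter (x : E) : ProperFilter (nbhs x).
Proof.
apply: Build_ProperFilter_ex.
  by move=> U [W B WU]; exists (x + 0); exact: (WU _ (flc_base0 B)).
split.
- by exists setT => //; exact: flc_baseT.
- move=> P Q [W1 B1 P1] [W2 B2 P2]; exists (W1 `&` W2); first exact: flc_baseI.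
  by move=> w [? ?]; split; [exact: P1|exact: P2].
- by move=> P Q PQ [W B PW]; exists W => // w Ww; exact/PQ/PW.
Qed.

Let flc_nbhs_singleton (x : E) (U : set E) : nbhs x U -> U x.
Proof. by move=> [W /flc_base0 W0 /(_ _ W0)]; rewrite addr0. Qed.

Let flc_nbhs_nbhs (x : E) (U : set E) : nbhs x U -> nbhs x (nbhs^~ U).
Proof.
move=> [W B WU]; have [W' B' WW'] := flc_base_split B.
exists W' => // w W'w; exists W' => // w' W'w'.
by rewrite -addrA; apply/WU/WW'.
Qed.

HB.instance Definition _ := Nbhs_isNbhsTopological.Build E
  flc_nbhs_filter flc_nbhs_singleton flc_nbhs_nbhs.

Let flc_add_continuous : continuous (fun x : E * E => x.1 + x.2).
Proof.
move=> [x y] U /= [W B WU]; have [W' B' WW'] := flc_base_split B.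
exists ([set x + w | w in W'], [set y + w | w in W']) => /=.
  by split; exists W' => // w W'w; exists w.
move=> [_ _] /= [[u Wu <-] [v Wv <-]].
by rewrite addrACA; apply/WU/WW'.
Qed.

Let flc_scale_continuous : continuous (fun z : R^o * E => z.1 *: z.2).
Proof.
move=> [r x] U /= [W B WU]; have [W' B' WW'] := flc_base_split B.
have [_ a _] := B'; have [l l0 [u W'u ux]] := a x.
have c0 : 0 < `|r| + 1 by rewrite ltr_wpDl.
pose d : R := Num.min 1 l^-1.
have d0 : 0 < d by rewrite lt_min ltr01 invr_gt0.
exists (ball (r : R^o) d, [set x + w | w in [set w | W' ((`|r| + 1) *: w)]]).
  split; first exact: nbhsx_ballx.
  by exists [set w | W' ((`|r| + 1) *: w)]; [exact: flc_baseZ|move=> w ?; exists w].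
move=> [s _] /= [rs [w W'w <-]].
have {}rs : `|s - r| < d by move: rs; rewrite /ball/= distrC.
have -> : s *: (x + w) = r *: x + ((s - r) *: x + s *: w).
  by rewrite scalerDr addrA -scalerDl [r + _]addrC subrK.
apply/WU/WW'.
- rewrite -ux scalerA; apply: flc_base_sym => //.
  rewrite normrM (gtr0_norm l0) -ler_pdivlMr// mul1r.
  by rewrite (le_trans (ltW rs))// ge_min lexx orbT.
- have -> : s *: w = (s / (`|r| + 1)) *: ((`|r| + 1) *: w).
    by rewrite scalerA divfK// gt_eqF.
  apply: flc_base_sym => //.
  rewrite normrM normfV (gtr0_norm c0) ler_pdivrMr// mul1r.
  rewrite -(subrK r s) addrC (le_trans (ler_normD _ _))// lerD2l.
  by rewrite (le_trans (ltW rs))// ge_min lexx.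
Qed.

Let flc_locally_convex :
  exists2 B : set_system E, (forall b, b \in B -> convex_set b) & basis B.
Proof.
exists [set U | open U /\ convex_set U]; first by move=> b; rewrite inE => -[].
split; first by move=> b [].
move=> x U [W B WU].
pose C : set E := [set x + w | w in W].
have CU : C `<=` U by move=> _ [w Ww <-]; exact: WU.
exists (C°) => /=; last exact: (subset_trans (@interior_subset _ _) CU).
split; last by exists W => // w Ww; exists w.
split; first exact: open_interior.
move=> y z t; rewrite !inE => -[W1 B1 C1] [W2 B2 C2].
exists (W1 `&` W2); first exact: flc_baseI.
move=> w [/C1[u Wu uE] /C2[v Wv vE]].
exists (t%:num *: u + (1 - t%:num) *: v).
  by apply: flc_base_conv => //; rewrite ?subr_ge0 // addrC subrK.
have -> : u = y + (w - x) by rewrite addrA -uE addrAC subrr add0r.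
have -> : v = z + (w - x) by rewrite addrA -vE addrAC subrr add0r.
rewrite scalerDr [(1 - _) *: _]scalerDr addrACA -scalerDl.
have -> : t%:num + (1 - t%:num) = 1 :> R by rewrite addrC subrK.
by rewrite scale1r addrCA [x + _]addrC subrK.
Qed.

(* This factory only provides the uniform structure. *)
HB.instance Definition _ := PreTopologicalLmod_isTvs.Build R E
  flc_add_continuous flc_scale_continuous flc_locally_convex.
HB.instance Definition _ :=
  PreTopologicalNmodule_isTopologicalNmodule.Build E flc_add_continuous.
HB.instance Definition _ :=
  TopologicalNmodule_isTopologicalLmodule.Build R E flc_scale_continuous.
HB.instance Definition _ := Uniform_isTvs.Build R E flc_locally_convex.

End Topology.
End FinestLocallyConvexTopology.

Section Closures.
Variables (R : realType) (A : comPzRingType) (phi : {rmorphism R -> A}).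

Definition flc_closure (C : set A) : set A :=
  closure (C : set (finest_lc (ralg phi))).

Definition seq_closure (C : set A) : set A :=
  [set x | exists2 u : nat -> finest_lc (ralg phi),
     forall n, C (u n) & u @ \oo --> (x : finest_lc (ralg phi))].

End Closures.

Section Semiorderings.
Variable A : comPzRingType.
Implicit Types (I M Q : set A) (Y : set (set A)).

Definition quadratic_module Q :=
  [/\ forall x y, Q x -> Q y -> Q (x + y),
      forall f x, Q x -> Q (f ^+ 2 * x)
    & Q 1].

Definition ideal I :=
  [/\ I 0, forall x y, I x -> I y -> I (x + y)
    & forall a x, I x -> I (a * x)].

Definition prime_ideal I :=
  [/\ ideal I, ~ I 1 & forall x y, I (x * y) -> I x \/ I y].

Definition opp_set Q : set A := -%R @` Q.

Definition semiordering Q :=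
  [/\ quadratic_module Q, Q `|` opp_set Q = setT
    & prime_ideal (Q `&` opp_set Q)].

Definition semiorderings_above M : set (set A) :=
  [set Q | semiordering Q /\ M `<=` Q].

Definition point_semiorderings (R : realType) M : set (set A) :=
  [set Q | semiorderings_above M Q /\
     exists2 alpha : {rmorphism A -> R},
       M `<=` alpha @^-1` [set r | 0 <= r] & Q = alpha @^-1` [set r | 0 <= r]].

Definition Pos Y : set A := \bigcap_(Q in Y) Q.

End Semiorderings.
Arguments point_semiorderings {A} R M.

(* Main.v *)
Require Import Defs.
From HB Require Import structures.
From mathcomp Require Import all_boot all_order all_algebra.
From mathcomp Require Import all_classical all_reals all_analysis.
From mathcomp Require Import ring lra.
Local Open Scope classical_set_scope.
Local Open Scope ring_scope.
Import Order.TTheory GRing.Theory Num.Theory.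

(** Every ring homomorphism [alpha : A -> R] is the identity on the scalars
    ([place_real]), hence linear, hence continuous for the finest locally convex
    topology. So [Pos] of the point semiorderings is closed
    ([place_nonneg_closed]); it contains [Pos] of all semiorderings above [M],
    and therefore its closure.

    The remaining inclusion, from the point semiorderings to the sequential
    closure, has the following source. Let [f] be nonnegative at every point
    semiordering, let [x_1, ..., x_n] generate [A], and put
    [q = 1 + f^2 + x_1^2 + ... + x_n^2]. Then [f + e q] lies in every semiordering
    [Q] above [M], for every real [e > 0]
    ([perturbation_in_semiordering]), and [f + q/(n+1)] converges to [f]
    ([seq_closure_ray]). The membership splits according to the size of [q]
    with respect to [Q].

    - If some real bounds [q] from above, then it bounds every [x_i^2], so all
      elements of [A] are bounded ([bounded_subalgebra]) and [Q] is archimedean.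
      Taking standard parts then gives a ring homomorphism [alpha] to the reals
      that is nonnegative on [Q] ([archimedean_semiordering_place]). It is
      nonnegative on [M], so [alpha f >= 0] and [alpha (f + e q) >= e > 0],
      which excludes [- (f + e q)] from [Q].
    - Otherwise [q] exceeds every real. Completing the square,
      [(e/2) f^2 + f + 1/(2e)] is in [Q]; half of [e q] dominates
      [(e/2) f^2], and the other half dominates the constant [1/(2e)].

    One [q] thus serves all semiorderings at once, with no recourse to the
    valuation theory of semiordered fields. *)

(** * Bounded and infinitesimal elements of a quadratic module *)

Section QuadraticModule.
Context {R : realType} {A : comPzRingType} (phi : {rmorphism R -> A}).
Context {Q : set A} (Qqm : quadratic_module Q).

Lemma qm_add {x y : A} : Q x -> Q y -> Q (x + y).
Proof. by case: Qqm => QD _ _; exact: QD. Qed.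

Lemma qm_sqM (f : A) {x : A} : Q x -> Q (f ^+ 2 * x).
Proof. by case: Qqm => _ QM _; exact: QM. Qed.

Lemma qm_sq (f : A) : Q (f ^+ 2).
Proof. by case: Qqm => _ _ /(qm_sqM f); rewrite mulr1. Qed.

Lemma qm_scale {r : R} {x : A} : 0 <= r -> Q x -> Q (phi r * x).
Proof. by move=> r0; rewrite -(sqr_sqrtr r0) rmorphXn; exact: qm_sqM. Qed.

Lemma qm_real {r : R} : 0 <= r -> Q (phi r).
Proof. by move=> r0; rewrite -(sqr_sqrtr r0) rmorphXn; exact: qm_sq. Qed.

Lemma qm_sum_sq (s : seq A) : Q (\sum_(x <- s) x ^+ 2).
Proof.
elim/big_ind: _ => [|x y|x _]; [|exact: qm_add|exact: qm_sq].
by have := qm_sq 0; rewrite expr0n.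
Qed.

(** This is [|a| <= r], where [x <= y] means that [y - x] is in [Q]. *)
Definition within (r : R) (a : A) := Q (phi r - a) /\ Q (phi r + a).

Lemma within_le {r s : R} {a : A} : r <= s -> within r a -> within s a.
Proof.
move=> rs [Qm Qp].
have Qsr : Q (phi (s - r)) by apply: qm_real; rewrite subr_ge0.
by split; rewrite -(subrK r s) rmorphD -addrA; exact: qm_add.
Qed.

Lemma within_real (r : R) : within `|r| (phi r).
Proof.
split; [rewrite -rmorphB|rewrite -rmorphD]; apply: qm_real.
  by rewrite subr_ge0 ler_norm.
by rewrite -lerBlDr sub0r -normrN ler_norm.
Qed.

Lemma withinN {r : R} {a : A} : within r a -> within r (- a).
Proof. by move=> [Qm Qp]; split; rewrite ?opprK. Qed.

Lemma withinD {r s : R} {a b : A} :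
  within r a -> within s b -> within (r + s) (a + b).
Proof.
move=> [am ap] [bm bp]; split; rewrite rmorphD.
  by rewrite opprD addrACA; exact: qm_add.
by rewrite addrACA; exact: qm_add.
Qed.

Lemma withinZ {c r : R} {a : A} : 0 <= c ->
  within r a -> within (c * r) (phi c * a).
Proof.
move=> c0 [Qm Qp].
by split; rewrite rmorphM -?mulrBr -?mulrDr; exact: qm_scale.
Qed.

(** A quadratic module need not be closed under products, so [r^2 - a^2] cannot
    be read off from the factors [r - a] and [r + a]. It is recovered from
    [2r (r^2 - a^2) = (r + a)^2 (r - a) + (r - a)^2 (r + a)], whose terms are
    squares times elements of [Q]. *)
Lemma within_sqr {r : R} {a : A} : 0 < r -> within r a -> within (r ^+ 2) (a ^+ 2).
Proof.
move=> r0 [Qm Qp]; split; last first.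
  by apply: qm_add (qm_sq _); apply: qm_real; exact: exprn_ge0 (ltW r0).
have c0 : 0 <= (2 * r)^-1 by rewrite invr_ge0 mulr_ge0 ?ltW.
have := qm_scale c0 (qm_add (qm_sqM (phi r + a) Qm) (qm_sqM (phi r - a) Qp)).
have -> : (phi r + a) ^+ 2 * (phi r - a) + (phi r - a) ^+ 2 * (phi r + a)
  = phi (2 * r) * (phi (r ^+ 2) - a ^+ 2) by ring.
by rewrite mulrA -rmorphM mulVf ?rmorph1 ?mul1r// mulf_neq0// ?pnatr_eq0 ?gt_eqF.
Qed.

Lemma phi_halfD : phi 2^-1 + phi 2^-1 = 1.
Proof. by rewrite -rmorphD -(rmorph1 phi); congr (phi _); lra. Qed.

(** By polarization, [2ab = (a + b)^2 - a^2 - b^2], from the case of squares. *)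
Lemma withinM {r s : R} {a b : A} : 0 < r -> 0 < s ->
  within r a -> within s b ->
  within (2^-1 * ((r + s) ^+ 2 + (r ^+ 2 + s ^+ 2))) (a * b).
Proof.
move=> r0 s0 ra sb.
have -> : a * b = phi 2^-1 * ((a + b) ^+ 2 + - (a ^+ 2 + b ^+ 2)).
  by rewrite (_ : _ + _ = a * b + a * b); [rewrite mulrDr -mulrDl phi_halfD mul1r|ring].
apply: withinZ; first by rewrite invr_ge0.
apply: withinD; first by apply: within_sqr; [exact: addr_gt0|exact: withinD].
by apply/withinN/withinD; exact: within_sqr.
Qed.

(** From [2 (a + (r + 1)/2) = (1 + a)^2 + (r - a^2)]. *)
Lemma within_sqr_bound {r : R} {a : A} :
  Q (phi r - a ^+ 2) -> within (2^-1 * (r + 1)) a.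
Proof.
move=> Qr.
have E b : b ^+ 2 = a ^+ 2 ->
    phi 2^-1 * ((1 + b) ^+ 2 + (phi r - a ^+ 2)) = phi (2^-1 * (r + 1)) + b.
  move=> <-.
  rewrite (_ : (1 + b) ^+ 2 + _ = phi (r + 1) + (b + b)); last by ring.
  rewrite mulrDr -rmorphM; congr (_ + _).
  by rewrite mulrDr -mulrDl phi_halfD mul1r.
have h0 : 0 <= 2^-1 :> R by rewrite invr_ge0.
by split; rewrite -E ?sqrrN//; apply: qm_scale => //; exact: qm_add (qm_sq _) Qr.
Qed.

Definition bounded_elt (a : A) := exists r, within r a.

Lemma bounded_elt_gt0 {a : A} : bounded_elt a -> exists2 r, 0 < r & within r a.
Proof.
move=> [r ra]; exists (`|r| + 1); first by rewrite ltr_wpDl.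
by apply: within_le ra; rewrite ler_wpDr// ler_norm.
Qed.

Lemma bounded_subalgebra : subalgebra phi bounded_elt.
Proof.
split=> [r|a b [r ra] [s sb]|].
- by exists `|r|; exact: within_real.
- by exists (r + s); exact: withinD.
- move=> a b /bounded_elt_gt0[r r0 ra] /bounded_elt_gt0[s s0 sb].
  by eexists; exact: withinM r0 s0 ra sb.
Qed.

Definition infinitesimal (a : A) := forall e, 0 < e -> within e a.

Lemma infinitesimalN {a : A} : infinitesimal a -> infinitesimal (- a).
Proof. by move=> ia e e0; apply/withinN/ia. Qed.

Lemma infinitesimalD {a b : A} :
  infinitesimal a -> infinitesimal b -> infinitesimal (a + b).
Proof.
move=> ia ib e e0; rewrite (splitr e).
by apply: withinD; [apply: ia|apply: ib]; rewrite divr_gt0.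
Qed.

(** With [d] as bound for both factors, [withinM] bounds the product by
    [3 d^2], which is at most [3 d] when [d <= 1]. *)
Lemma infinitesimalM {a b : A} :
  infinitesimal a -> infinitesimal b -> infinitesimal (a * b).
Proof.
move=> ia ib e e0; pose d : R := Num.min 1 (e / 3).
have d0 : 0 < d by rewrite lt_min ltr01 divr_gt0.
have d1 : d <= 1 by rewrite ge_min lexx.
have de : d <= e / 3 by rewrite ge_min lexx orbT.
apply: within_le (withinM d0 d0 (ia _ d0) (ib _ d0)).
by nra.
Qed.

Lemma infinitesimalZ (c : R) {a : A} :
  infinitesimal a -> infinitesimal (phi c * a).
Proof.
wlog c0 : c a / 0 <= c.
  move=> H; have [c0|/ltW c0 ia] := leP 0 c; first exact: H.
  rewrite -(opprK c) rmorphN mulNr -mulrN.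
  by apply: H; rewrite ?oppr_ge0//; exact: infinitesimalN.
move=> ia e e0.
have c1 : 0 < c + 1 by rewrite ltr_wpDl.
apply: within_le (withinZ c0 (ia _ (divr_gt0 e0 c1))).
by rewrite mulrCA ger_pMr// ler_pdivrMr// mul1r lerDl.
Qed.

End QuadraticModule.

(** * The real place of an archimedean semiordering *)

Section Place.
Context {R : realType} {A : comPzRingType} (phi : {rmorphism R -> A}).
Context {Q : set A} (Qso : semiordering Q).

Let Qqm : quadratic_module Q. Proof. by case: Qso. Qed.

Lemma semiordering_total (a : A) : Q a \/ Q (- a).
Proof.
case: Qso => _ QT _; have : (Q `|` opp_set Q) a by rewrite QT.
by case=> [|[b Qb <-]]; [left|right; rewrite opprK].
Qed.

Lemma semiordering_real_ge0 {r : R} : Q (phi r) -> 0 <= r.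
Proof.
move=> Qr; rewrite leNgt; apply/negP => r0.
have QN1 : Q (- 1).
  have r1 : 0 <= - r^-1 by rewrite oppr_ge0 invr_le0 ltW.
  have := qm_scale phi Qqm r1 Qr.
  by rewrite -rmorphM mulNr mulVf ?lt_eqF// rmorphN1.
case: Qso => _ _ [_ + _]; apply; split; first by case: Qqm.
by exists (- 1); rewrite ?opprK.
Qed.

Lemma infinitesimal_real {r : R} : infinitesimal phi (Q := Q) (phi r) -> r = 0.
Proof.
move=> ir; apply/eqP; rewrite eq_le; apply/andP; split; apply/ler_addgt0Pr => e e0;
  have [Qm Qp] := ir _ e0.
- by move: Qm; rewrite -rmorphB => /semiordering_real_ge0; rewrite add0r subr_ge0.
- by move: Qp; rewrite -rmorphD => /semiordering_real_ge0; rewrite addrC.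
Qed.

(** The standard part is the cut that [a] makes in the reals,
    the supremum of the [t] with [a - t] in [Q]; totality of [Q] turns
    failure of [a - t] to lie in [Q] into the upper estimate. *)
Lemma bounded_standard_part {a : A} : bounded_elt phi (Q := Q) a ->
  exists c, infinitesimal phi (Q := Q) (a - phi c).
Proof.
move=> [r [Qm Qp]]; pose S := [set t | Q (a - phi t)].
have Sr : S (- r) by rewrite /S/= rmorphN opprK addrC.
have ubS : ubound S r.
  move=> t St; have := qm_add Qqm Qm St.
  by rewrite addrA subrK -rmorphB => /semiordering_real_ge0; rewrite subr_ge0.
have hS : has_sup S by split; [exists (- r)|exists r].
exists (sup S) => e e0; split.
- have nS : ~ S (sup S + e).
    by move=> /(ub_le_sup (ex_intro _ _ ubS)); rewrite gerDl leNgt e0.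
  have [//|] := semiordering_total (a - phi (sup S + e)).
  by rewrite rmorphD !opprB addrAC addrC addrA [phi _ + _]addrC -addrA; congr Q; ring.
- have [t St et] := sup_adherent e0 hS.
  have := qm_add Qqm St (qm_real phi Qqm (_ : 0 <= t - (sup S - e))).
  rewrite subr_ge0 (ltW et) !rmorphB => /(_ isT); congr Q; ring.
Qed.

(** The standard part [al a] is characterized by [a - al a] being infinitesimal.
    It is additive since infinitesimals form a subgroup. It is multiplicative
    since, for [a = al a + i] and [b = al b + j], the difference
    [a b - al a * al b] is [al a * j + al b * i + i j]: only real multiples of
    infinitesimals and products of two infinitesimals occur. *)
Theorem archimedean_semiordering_place :
  (forall a, bounded_elt phi (Q := Q) a) ->
  exists alpha : {rmorphism A -> R}, forall a, Q a -> 0 <= alpha a.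
Proof.
move=> Qb; pose al a := projT1 (cid (bounded_standard_part (Qb a))).
have alP a : infinitesimal phi (Q := Q) (a - phi (al a)).
  by rewrite /al; case: cid.
have alE a c : infinitesimal phi (Q := Q) (a - phi c) -> al a = c.
  move=> iac; apply/eqP; rewrite -subr_eq0; apply/eqP/infinitesimal_real.
  rewrite rmorphB (_ : _ - _ = (a - phi c) + - (a - phi (al a))); last by ring.
  exact: (infinitesimalD phi Qqm) iac (infinitesimalN phi (alP a)).
have alB : zmod_morphism al.
  move=> a b; apply: alE; rewrite rmorphB.
  rewrite (_ : _ - _ = (a - phi (al a)) + - (b - phi (al b))); last by ring.
  exact: (infinitesimalD phi Qqm) (alP a) (infinitesimalN phi (alP b)).
have alM : monoid_morphism al.
  split=> [|a b]; apply: alE; rewrite ?rmorph1 ?subrr ?rmorphM.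
    move=> e e0; split; rewrite ?subr0 ?addr0; apply: (qm_real phi Qqm); exact: ltW.
  set i := a - phi (al a); set j := b - phi (al b).
  rewrite (_ : _ - _ = phi (al a) * j + phi (al b) * i + i * j); last by rewrite /i /j; ring.
  apply: (infinitesimalD phi Qqm); last exact: (infinitesimalM phi Qqm) (alP a) (alP b).
  by apply: (infinitesimalD phi Qqm); apply: (infinitesimalZ phi Qqm); exact: alP.
pose alpha : {rmorphism A -> R} :=
  HB.pack al (GRing.isZmodMorphism.Build A R al alB)
             (GRing.isMonoidMorphism.Build A R al alM).
exists alpha => a Qa; apply/ler_addgt0Pr => e /(alP a)[Qm _].
have := qm_add Qqm Qm Qa; rewrite opprB addrA subrK -rmorphD addrC.
exact: semiordering_real_ge0.
Qed.
End Place.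

(** * Real characters of the algebra *)

Section RealCharacters.
Context {R : realType}.

(** Squares go to squares, so [psi] is monotone; it fixes the rationals, which
    are dense. *)
Lemma real_endomorphism_id (psi : {rmorphism R -> R}) (r : R) : psi r = r.
Proof.
have psi_le : {homo psi : x y / x <= y}.
  move=> x y; rewrite -subr_ge0 => xy; rewrite -subr_ge0 -rmorphB.
  by rewrite -(sqr_sqrtr xy) rmorphXn sqr_ge0.
have [rpsi|psir|//] := ltgtP r (psi r).
- have [q] := rat_in_itvoo rpsi; rewrite in_itv/= => /andP[/ltW /psi_le].
  by rewrite fmorph_rat => /le_lt_trans/[apply]; rewrite ltxx.
- have [q] := rat_in_itvoo psir; rewrite in_itv/= => /andP[+ /ltW /psi_le].
  by rewrite fmorph_rat => /lt_le_trans/[apply]; rewrite ltxx.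
Qed.

Context {A : comPzRingType} (phi : {rmorphism R -> A}).

Lemma place_real (alpha : {rmorphism A -> R}) (r : R) : alpha (phi r) = r.
Proof. exact: (real_endomorphism_id (alpha \o phi)). Qed.

Lemma place_nonneg_semiordering (alpha : {rmorphism A -> R}) :
  semiordering (alpha @^-1` [set r | 0 <= r]).
Proof.
set Q := _ @^-1` _.
have suppE x : (Q `&` opp_set Q) x <-> alpha x = 0.
  split=> [[Qx [y Qy yx]]|x0]; last first.
    by split; [rewrite /Q/= x0|exists (- x); rewrite ?opprK// /Q/= rmorphN x0 oppr0].
  apply/eqP; rewrite eq_le [X in _ && X]Qx andbT.
  by rewrite -yx rmorphN oppr_le0; exact: Qy.
split.
- split=> [x y|f x|]; rewrite /Q/=.
  + by rewrite rmorphD; exact: addr_ge0.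
  + by rewrite rmorphM rmorphXn => x0; rewrite mulr_ge0// sqr_ge0.
  + by rewrite rmorph1.
- apply/seteqP; split=> // x _; have [x0|x0] := leP 0 (alpha x); [by left|right].
  by exists (- x); rewrite ?opprK// /Q/= rmorphN oppr_ge0 ltW.
- split=> [| |x y]; first split=> [|x y|a x]; rewrite !suppE.
  + exact: rmorph0.
  + by rewrite rmorphD => -> ->; rewrite addr0.
  + by rewrite rmorphM => ->; rewrite mulr0.
  + by rewrite rmorph1; apply/eqP; exact: oner_neq0.
  + by rewrite rmorphM => /eqP; rewrite mulf_eq0 => /orP[] /eqP; [left|right].
Qed.

(** These slabs witness the continuity at [0] of [alpha], which is linear by
    [place_real]. *)
Lemma place_slab_flc_base (alpha : {rmorphism A -> R}) (d : R) : 0 < d ->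
  flc_base ([set w | `|alpha w| < d] : set (ralg phi)).
Proof.
move=> d0.
have alD (u v : ralg phi) : alpha (u + v) = alpha u + alpha v by exact: rmorphD.
have alZ (l : R) (w : ralg phi) : alpha (l *: w) = l * alpha w.
  by rewrite rmorphM place_real.
split.
- move=> u v l; rewrite !inE/= => du dv.
  have -> : conv l u v = l%:num *: u + (1 - l%:num) *: v :> ralg phi by [].
  rewrite alD !alZ; have l0 : 0 <= l%:num by [].
  have l1 : 0 <= 1 - l%:num by rewrite subr_ge0.
  pose m := Num.max `|alpha u| `|alpha v|.
  have md : m < d by rewrite gt_max du dv.
  apply: le_lt_trans md; apply: le_trans (ler_normD _ _) _.
  rewrite !normrM (ger0_norm l0) (ger0_norm l1).
  have -> : m = l%:num * m + (1 - l%:num) * m by ring.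
  by apply: lerD; apply: ler_wpM2l => //; rewrite le_max lexx ?orbT.
- move=> u; pose l := (`|alpha u| + 1) / d.
  have l0 : 0 < l by rewrite divr_gt0// ltr_wpDl.
  exists l => //; exists (l^-1 *: u); last by rewrite scalerA mulfV ?scale1r ?gt_eqF.
  rewrite /= alZ normrM normfV (gtr0_norm l0) mulrC ltr_pdivrMr//.
  by rewrite /l mulrC divfK ?gt_eqF// ltrDl.
- move=> l l1 _ [w wd <-]; rewrite /= alZ normrM.
  by apply: le_lt_trans wd; rewrite ler_piMl.
Qed.

Lemma place_nonneg_closed (alpha : {rmorphism A -> R}) (C : set A) :
  C `<=` alpha @^-1` [set r | 0 <= r] ->
  flc_closure phi C `<=` alpha @^-1` [set r | 0 <= r].
Proof.
move=> C0 x clx /=; rewrite leNgt; apply/negP => x0.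
pose W : set (ralg phi) := [set w | `|alpha w| < - alpha x].
have : nbhs (x : finest_lc (ralg phi)) [set x + w | w in W].
  exists W => [|w Ww]; last by exists w.
  by apply: place_slab_flc_base; rewrite oppr_gt0.
move=> /clx[y [/C0/= + [w Ww xwy]]]; rewrite -{y}xwy.
rewrite (rmorphD alpha) leNgt => /negP; apply.
by rewrite addrC -ltrBrDr sub0r (le_lt_trans (ler_norm _)).
Qed.
End RealCharacters.

(** * Sequential closure and closure *)

Section Closures.
Context {R : realType} {A : comPzRingType} (phi : {rmorphism R -> A}).

Lemma seq_closure_sub_flc_closure (C : set A) :
  seq_closure phi C `<=` flc_closure phi C.
Proof.
move=> x [u uC ux] U /ux Uu.
have [n Un] := @filter_ex _ \oo _ (u @^-1` U) Uu.
by exists (u n).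
Qed.

(** The sequence [f + q/(n+1)] converges to [f] because a basic neighbourhood
    [W] of [0] absorbs [q]. *)
Lemma seq_closure_ray (C : set A) (f q : A) :
  (forall e : R, 0 < e -> C (f + phi e * q)) -> seq_closure phi C f.
Proof.
move=> Cq; exists (fun n => f + phi n.+1%:R^-1 * q) => [n|].
  by apply: Cq; rewrite invr_gt0.
move=> U [W WB WU].
have [_ Wa _] := WB; have [l l0 [w Ww wq]] := Wa q.
suff : \forall n \near \oo, W (phi n.+1%:R^-1 * q) by apply: filterS => n /WU.
near=> n.
have -> : phi n.+1%:R^-1 * q = (n.+1%:R^-1 * l) *: (w : ralg phi).
  by rewrite -scalerA wq.
apply: flc_base_sym => //.
rewrite ger0_norm; last by rewrite mulr_ge0 ?invr_ge0// ltW.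
rewrite mulrC ler_pdivrMr// mul1r.
apply: le_trans (_ : l <= n%:R) _; last by rewrite ler_nat.
near: n; exact: nbhs_infty_ger.
Unshelve. all: by end_near.
Qed.
End Closures.

(** * Perturbation into all semiorderings *)

Section Approximation.
Context {R : realType} {A : comPzRingType} (phi : {rmorphism R -> A}).
Context {M : set A}.

(** The perturbation must dominate three things modulo sums of squares: the
    squares of the generators, so that a bound on it makes [A] archimedean;
    [f^2], so that it absorbs [f] when unbounded; and [1], so that it is
    positive at every real point. *)
Definition growth (s : seq A) (f : A) : A := 1 + (f ^+ 2 + \sum_(x <- s) x ^+ 2).

Lemma perturbation_in_semiordering (s : seq A) (f : A) (Q : set A) (e : R) :
  smallest (subalgebra phi) [set` s] = setT ->
  Pos (point_semiorderings R M) f -> semiorderings_above M Q -> 0 < e ->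
  Q (f + phi e * growth s f).
Proof.
move=> gen f0 [Qso MQ] e0; have [Qqm _ _] := Qso.
have Qsum := qm_sum_sq Qqm.
have q1 : Q (growth s f - 1).
  by rewrite /growth addrC addKr; exact: (qm_add Qqm) (qm_sq Qqm _) (Qsum _).
have [[r Qr]|unb] := pselect (exists r, Q (phi r - growth s f)).
(* [growth s f] is bounded by [r], hence so are the generators. *)
- have bd a : bounded_elt phi (Q := Q) a.
    have : setT a by [].
    rewrite -gen; apply: smallest_sub; first exact: bounded_subalgebra Qqm.
    move=> x /= xs; exists (2^-1 * (r + 1)); apply: (within_sqr_bound phi Qqm).
    have := qm_add Qqm Qr (qm_add Qqm (qm_sq Qqm f) (Qsum (rem x s))).
    move=> /(fun H => qm_add Qqm H (qm_sq Qqm 1)).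
    by rewrite /growth (big_rem x)//=; congr Q; ring.
  have [alpha al0] := archimedean_semiordering_place phi Qso bd.
  have alf : 0 <= alpha f.
    apply: (f0 (alpha @^-1` [set r | 0 <= r])).
    split; last by exists alpha => // x /MQ /al0.
    by split; [exact: place_nonneg_semiordering|move=> x /MQ /al0].
  have [//|/al0] := semiordering_total Qso (f + phi e * growth s f).
  have := al0 _ q1; rewrite rmorphB rmorph1 subr_ge0 => alq.
  rewrite rmorphN oppr_ge0 rmorphD rmorphM (place_real phi).
  rewrite leNgt => /negP[].
  by rewrite ltr_wpDl// mulr_gt0// (lt_le_trans ltr01).
(* [growth s f] exceeds every real. *)
- have Qinf r : Q (growth s f - phi r).
    have [Qr|] := semiordering_total Qso (phi r - growth s f); last by rewrite opprB.
    by case: unb; exists r.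
  pose h := phi (e / 2); pose w := phi e^-1.
  have eh : phi e = h + h by rewrite -rmorphD -splitr.
  have hw : h * w + h * w = 1.
    by rewrite -mulrDl -eh -rmorphM mulfV ?rmorph1 ?gt_eqF.
  (* The constant [e^-2] is what the square of [f + 1/e] leaves over. *)
  have -> : f + phi e * growth s f =
      h * ((f + w) ^+ 2 + ((1 + \sum_(x <- s) x ^+ 2) + (growth s f - phi (e^-1 ^+ 2)))).
    rewrite rmorphXn eh -[X in X + _ = _]mul1r -{1}hw /growth -/w; ring.
  apply: (qm_scale phi Qqm); first by rewrite divr_ge0 ?ltW.
  apply: (qm_add Qqm) (qm_sq Qqm _) _; apply: (qm_add Qqm) _ (Qinf _).
  by apply: (qm_add Qqm) (Qsum _); rewrite -(expr1n A 2); exact: qm_sq.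
Qed.
End Approximation.

Theorem proposition2p4 (R : realType) (A : comPzRingType)
    (phi : {rmorphism R -> A}) (M : set A) :
  finitely_generated phi -> quadratic_module M ->
  Pos (point_semiorderings R M) = seq_closure phi (Pos (semiorderings_above M))
  /\ seq_closure phi (Pos (semiorderings_above M)) =
     flc_closure phi (Pos (semiorderings_above M)).
Proof.
move=> [s gen] _; set Y := Pos (semiorderings_above M).
have K_sub : Pos (point_semiorderings R M) `<=` seq_closure phi Y.
  move=> f f0; apply: (@seq_closure_ray _ _ _ _ _ (growth s f)) => e e0 Q MQ.
  exact: perturbation_in_semiordering gen f0 MQ e0.
have cl_sub : flc_closure phi Y `<=` Pos (point_semiorderings R M).
  move=> f clf Q [MQ [alpha _ QE]]; rewrite QE.
  by apply: place_nonneg_closed clf => g Yg; rewrite -QE; exact: Yg.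
have sc := @seq_closure_sub_flc_closure _ _ phi Y.
split; apply/seteqP; split=> //.
- exact: subset_trans sc cl_sub.
- exact: subset_trans cl_sub K_sub.
Qed.
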